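(* Let $p>2$ be a prime, and let $r$, $s$, $t$ be any positive integers. Then $$\sum_{m_1=0}^{rp-1}\sum_{m_2=0}^{sp-1}\sum_{m_3=0}^{tp-1}\binom{m_1+m_2+m_3}{m_1,m_2,m_3}\equiv \sum_{m_1=0}^{r-1}\sum_{m_2=0}^{s-1}\sum_{m_3=0}^{t-1}\binom{m_1+m_2+m_3}{m_1,m_2,m_3}\pmod{p^3}.$$
   Context: For non-negative integers $m_1,m_2,m_3$, $\binom{m_1+m_2+m_3}{m_1,m_2,m_3}=\frac{(m_1+m_2+m_3)!}{m_1!\,m_2!\,m_3!}$ is the multinomial coefficient. *)

(* Defs.v *)
(* MathComp. *)
From mathcomp Require Import all_boot.

Set Implicit Arguments.
Unset Strict Implicit.
Unset Printing Implicit Defensive.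

Definition trinomial (m1 m2 m3 : nat) : nat :=
  (m1 + m2 + m3)`! %/ (m1`! * m2`! * m3`!).

(* The division in [trinomial] is exact. *)
Lemma trinomial_fact (m1 m2 m3 : nat) :
  trinomial m1 m2 m3 * (m1`! * m2`! * m3`!) = (m1 + m2 + m3)`!.
Proof.
rewrite /trinomial divnK //.
have H12 := bin_fact (leq_addr m2 m1); rewrite addKn in H12.
have H := bin_fact (leq_addr m3 (m1 + m2)); rewrite addKn in H.
by rewrite -H -H12 -(mulnA _ (m1`! * m2`!)) mulnA dvdn_mull.
Qed.

(* Main.v *)
Require Import Defs.
From mathcomp Require Import all_boot all_algebra all_field cyclic.
From mathcomp Require Import ring zify.

Set Implicit Arguments.
Unset Strict Implicit.
Unset Printing Implicit Defensive.

Import GRing.Theory.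

(** Cutting each range of summation into blocks of length [p], it is enough to
    show that every block sum, over [0 <= i, j, k < p], of
    [trinomial (a p + i) (b p + j) (c p + k)] is congruent to
    [trinomial a b c] modulo [p ^ 3].  Work in a commutative ring where
    [p ^ 3 = 0] and where [1, ..., p - 1] are units.  With the rising product
    [rise x m = (x + 1) ... (x + m)], the block sum is
    [trinomial (a p) (b p) (c p)] times

      S (a, b, c) = sum over i, j, k < p of
        rise (p (a + b + c)) (i + j + k)
          / (rise (p a) i * rise (p b) j * rise (p c) k),

    which makes sense for all ring elements [a], [b], [c]; it is symmetric, and
    since [p ^ 3 = 0] it is a polynomial of degree at most 2 in them.  Such a
    polynomial can be identified by evaluating it at well-chosen arguments.

    - On the axis, S (t, 0, 0) = 1 for all [t] ([blocksum_axis1]).  Here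
      S (t, 0, 0) is the sum over i < p of Q (p t + i) for a polynomial [Q] of
      degree at most [2 p - 2].  Its coefficient at [t ^ 2] vanishes: [p]
      divides the power sums over a residue system that enter it, except for
      the exponent [p - 1], whose coefficient is itself divisible by [p].
      Hence S (t, 0, 0) is affine in [t], and its values at [-1] and [-2] are
      alternating sums of binomial coefficients, equal to 1.
    - On the line b = -1 - a, c = 0, most terms cancel in alternating sums of
      binomial coefficients, and S (a, -1 - a, 0) is
      (p - 1)! / rise (p a) (p - 1) ([blocksum_plane]).  The denominator is
      quadratic in [a], with the value (p - 1)! at 0 and -1, so it equals
      (p - 1)! (1 + w a (a + 1)) with a multiple [w] of [p ^ 2].  Moreover
      [3 w = 0]: for [p > 3] even [w = 0], because [p] divides the sum of the
      inverse squares, as in Wolstenholme's theorem ([rise_quad]).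

    Therefore S (a, b, c) = 1 + w (a b + b c + c a) ([blocksum_quad]).  On the
    other hand, writing each [(p n)!] as [p ^ n n!] times a product of values of
    [rise] compares [trinomial (a p) (b p) (c p)] with [trinomial a b c] up to a
    factor [1 + w d], with an integer [d].  The resulting error term is
    [w * trinomial a b c * ((a + b + c + 1) (a b + b c + c a) - a b c)], and it
    vanishes: [3 w = 0], while 3 divides the integer factor
    ([dvd3_trinomial2] and [dvd3_trinomial3]).  For [p > 3] one has [w = 0], so
    this last divisibility matters only for [p = 3]. *)

(** * Trinomial coefficients *)

Lemma trinomialC (a b c : nat) : trinomial a b c = trinomial b a c.
Proof. by rewrite /trinomial (addnC a) (mulnC a`!). Qed.

Lemma trinomialAC (a b c : nat) : trinomial a b c = trinomial a c b.
Proof. by rewrite /trinomial addnAC mulnAC. Qed.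

Lemma fact_gt0_mul3 (a b c : nat) : 0 < a`! * b`! * c`!.
Proof. by rewrite !muln_gt0 !fact_gt0. Qed.

Lemma dvd3_consecutive (n : nat) : 3 %| n * n.+1 * n.+2.
Proof.
have [q [r [-> r3]]] : exists q r, n = q * 3 + r /\ r < 3.
  by exists (n %/ 3), (n %% 3); rewrite -divn_eq ltn_mod.
case: r r3 => [|[|[|//]]] _; apply/dvdnP.
- exists (q * (q * 3).+1 * (q * 3).+2); ring.
- exists ((q * 3 + 1) * (q * 3 + 2) * q.+1); ring.
- exists ((q * 3 + 2) * q.+1 * (q * 3 + 4)); ring.
Qed.

(** With n = a + b + c and [a], [b] positive, [trinomial a b c * (a b)] is
    n (n - 1) times a trinomial coefficient, and (n - 1) n (n + 1) is divisible by 3. *)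
Lemma dvd3_trinomial2 (a b c : nat) :
  3 %| trinomial a b c * (a * b * (a + b + c).+1).
Proof.
case: a b => [|a] [|b]; rewrite ?muln0 ?mul0n ?muln0 ?dvdn0 //.
have H := trinomial_fact a.+1 b.+1 c; have H' := trinomial_fact a b c.
have eN : a.+1 + b.+1 + c = (a + b + c).+2 by lia.
have E : trinomial a.+1 b.+1 c * (a.+1 * b.+1) =
         trinomial a b c * ((a + b + c).+1 * (a + b + c).+2).
  apply/eqP; rewrite -(eqn_pmul2r (fact_gt0_mul3 a b c)); apply/eqP.
  rewrite [RHS]mulnAC H'; move: H; rewrite eN !factS => H.
  by apply: (etrans _ (etrans H _)); ring.
rewrite mulnA E -mulnA dvdn_mull // eN.
exact: dvd3_consecutive.
Qed.

(** With n = a + b + c and positive arguments, [trinomial a b c * (a b c)] is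
    n (n - 1) (n - 2) times a trinomial coefficient. *)
Lemma dvd3_trinomial3 (a b c : nat) :
  3 %| trinomial a b c * (a * b * c).
Proof.
case: a b c => [|a] [|b] [|c]; rewrite ?muln0 ?mul0n ?muln0 ?dvdn0 //.
have H := trinomial_fact a.+1 b.+1 c.+1; have H' := trinomial_fact a b c.
have eN : a.+1 + b.+1 + c.+1 = (a + b + c).+3 by lia.
have -> : trinomial a.+1 b.+1 c.+1 * (a.+1 * b.+1 * c.+1) =
  trinomial a b c * ((a + b + c).+1 * (a + b + c).+2 * (a + b + c).+3).
  apply/eqP; rewrite -(eqn_pmul2r (fact_gt0_mul3 a b c)); apply/eqP.
  rewrite [RHS]mulnAC H'; move: H; rewrite eN !factS => H.
  by apply: (etrans _ (etrans H _)); ring.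
exact/dvdn_mull/dvd3_consecutive.
Qed.

(** The sum of the pronic numbers [j (j + 1)] for [j < n], that is
    [(n ^ 3 - n) / 3]. *)
Definition pronic_sum (n : nat) : nat := \sum_(0 <= j < n) j * j.+1.

Lemma mul3_pronic_sum (n : nat) : 3 * pronic_sum n + n = n ^ 3.
Proof.
rewrite /pronic_sum; elim: n => [|n IH]; first by rewrite big_geq.
by rewrite big_nat_recr //= mulnDr -addnA addnCA addnA; nia.
Qed.

(** Equivalent to
    (a + b + c)^3 - a^3 - b^3 - c^3 = 3 (a + b) (b + c) (c + a). *)
Lemma pronic_sumD (a b c : nat) :
  pronic_sum (a + b + c) + a * b * c =
  pronic_sum a + pronic_sum b + pronic_sum c +
  (a + b + c) * (a * b + b * c + c * a).
Proof.
have := mul3_pronic_sum (a + b + c); have := mul3_pronic_sum a.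
have := mul3_pronic_sum b; have := mul3_pronic_sum c.
nia.
Qed.

Lemma factD_ffact (n m : nat) : (n + m)`! = (n + m) ^_ m * n`!.
Proof. by rewrite -(ffact_fact (leq_addl n m)) addnK. Qed.

(** The coefficients in a block compared with its corner. *)
Lemma trinomialD (x y z i j k : nat) :
  trinomial (x + i) (y + j) (z + k) *
    ((x + i) ^_ i * (y + j) ^_ j * (z + k) ^_ k) =
  trinomial x y z * (x + y + z + (i + j + k)) ^_ (i + j + k).
Proof.
have := trinomial_fact (x + i) (y + j) (z + k).
rewrite (_ : x + i + (y + j) + (z + k) = x + y + z + (i + j + k)); last lia.
rewrite (factD_ffact (x + y + z)) (factD_ffact x) (factD_ffact y) (factD_ffact z).
rewrite -(trinomial_fact x y z) => H.
apply/eqP; rewrite -(eqn_pmul2r (fact_gt0_mul3 x y z)); apply/eqP.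
by apply: (etrans _ (etrans H _)); ring.
Qed.

Lemma fact_mul_p (p n : nat) : 0 < p ->
  (n * p)`! = p ^ n * n`! * \prod_(j < n) (j * p + p.-1) ^_ p.-1.
Proof.
move=> p0; elim: n => [|n IH]; first by rewrite big_ord0.
have e : n.+1 * p = (n * p + p.-1).+1 by rewrite -addnS prednK // mulSnr.
by rewrite big_ord_recr /= expnS factS e factS -e factD_ffact IH; ring.
Qed.

Lemma trinomial_mul_p (p a b c : nat) : 0 < p ->
  let G n := \prod_(j < n) (j * p + p.-1) ^_ p.-1 in
  trinomial (a * p) (b * p) (c * p) * (G a * G b * G c) =
  trinomial a b c * G (a + b + c).
Proof.
move=> p0 G; have := trinomial_fact (a * p) (b * p) (c * p).
rewrite -!mulnDl !fact_mul_p // -!/(G _) -(trinomial_fact a b c) !expnD => H.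
have P0 : 0 < p ^ a * p ^ b * p ^ c * (a`! * b`! * c`!).
  by rewrite muln_gt0 fact_gt0_mul3 !muln_gt0 !expn_gt0 p0.
apply/eqP; rewrite -(eqn_pmul2r P0); apply/eqP.
by move: H; rewrite -!/(G _) => H; rewrite -[LHS]mulnA; nia.
Qed.

(** * Power sums modulo a prime *)

(** In the prime field there is a nonzero [g] with [g ^ n <> 1], and scaling
    by [g] multiplies the sum of all [n]-th powers by [g ^ n]. *)
Lemma dvdn_sum_pow (p n : nat) : prime p -> ~~ (p.-1 %| n) ->
  p %| \sum_(0 <= i < p) i ^ n.
Proof.
move=> hp hn; have p1 := prime_gt1 hp.
have q0 : 0 < p.-1 by lia.
set r := n %% p.-1.
have r0 : 0 < r by rewrite lt0n.
have rp : r < p.-1 by rewrite ltn_mod.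
have [g g0 gn] : exists2 g : 'F_p, (g != 0)%R & (g ^+ n != 1)%R.
  have [/existsP[g /andP[g0 gr]]|/existsPn Hall] :=
    boolP [exists g : 'F_p, (g != 0)%R && (g ^+ n != 1)%R]; first by exists g.
  have Xr0 : ('X^r - 1 != 0 :> {poly 'F_p})%R.
    by rewrite -size_poly_eq0 size_XnsubC.
  have := max_poly_roots Xr0 (rs := enum (predC1 (0 : 'F_p)%R)).
  rewrite enum_uniq size_XnsubC // -cardE cardC1 card_Fp // ltnS leqNgt rp.
  (* Otherwise all [p - 1] nonzero elements are roots of [X ^ r - 1]. *)
  move=> H; suff /H/(_ isT) :
      all (root ('X^r - 1)%R) (enum (predC1 (0 : 'F_p)%R)) by [].
  apply/allP=> g; rewrite mem_enum inE => g0.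
  have := Hall g; rewrite g0 /= negbK (divn_eq n p.-1) -/r exprD mulnC exprM.
  have gp : (g ^+ p.-1 = 1)%R.
    apply: (mulfI g0); rewrite mulr1 -exprS prednK ?prime_gt0 //.
    by have := expf_card g; rewrite card_Fp.
  by rewrite gp expr1n mul1r rootE !hornerE => /eqP->; rewrite subrr.
have S0 : (\sum_(x : 'F_p) x ^+ n = 0)%R.
  have gI : injective (fun x : 'F_p => g * x)%R by exact: mulfI.
  apply/eqP; have: ((g ^+ n - 1) * (\sum_(x : 'F_p) x ^+ n) == 0)%R.
    rewrite mulrBl mul1r {2}(reindex_inj gI) /= mulr_sumr -sumrB.
    by apply/eqP/big1 => x _; rewrite exprMn subrr.
  by rewrite mulf_eq0 subr_eq0 (negPf gn).
have e : ((\sum_(0 <= i < p) i ^ n)%N%:R = 0 :> 'F_p)%R.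
  rewrite -S0 natr_sum.
  have -> : index_iota 0 p = index_iota 0 (Zp_trunc (pdiv p)).+2.
    by rewrite Fp_cast.
  by rewrite big_mkord; apply: eq_bigr => x _; rewrite natrX natr_Zp.
by rewrite (dvdn_pcharf (pchar_Fp hp)) e.
Qed.

(** * Rising products *)

Section Rise.
Local Open Scope ring_scope.
Variable R : comNzRingType.
Implicit Types x : R.

(** The product (x + 1) (x + 2) ... (x + m), which starts at [x + 1]. *)
Definition rise x (m : nat) : R := \prod_(l < m) (x + l.+1%:R).

Lemma rise0 x : rise x 0 = 1. Proof. exact: big_ord0. Qed.

Lemma riseS x m : rise x m.+1 = rise x m * (x + m.+1%:R).
Proof. exact: big_ord_recr. Qed.

Lemma riseD x m n : rise x (m + n) = rise x m * rise (x + m%:R) n.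
Proof.
rewrite /rise big_split_ord /=; congr (_ * _); apply: eq_bigr => l _.
by rewrite -addrA -natrD addnS.
Qed.

Lemma rise_nat n m : rise n%:R m = ((n + m) ^_ m)%:R.
Proof.
elim: m => [|m IH]; first by rewrite rise0.
by rewrite riseS IH -natrD -natrM addnS ffactSS mulnC.
Qed.

Lemma rise_fact m : rise 0 m = m`!%:R.
Proof. by rewrite (rise_nat 0) add0n ffactnn. Qed.

Lemma rise_opp M n : rise (- M.+1%:R) n = (-1) ^+ n * (M ^_ n)%:R.
Proof.
elim: n => [|n IH]; first by rewrite rise0 mulr1.
rewrite riseS IH ffactnSr; have [le_nM|lt_Mn] := leqP n M.
  by rewrite natrM natrB // exprS -!natr1; ring.
by rewrite ffact_small // mul0n mulr0 mul0r mulr0.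
Qed.

Lemma rise_reflect x m n :
  rise (- (m + n).+1%:R - x) m = (-1) ^+ m * rise (x + n%:R) m.
Proof.
rewrite /rise (reindex_inj rev_ord_inj) -[X in (-1) ^+ X](card_ord m) -prodrN.
apply: eq_bigr => l _ /=; rewrite subnSK // natrB 1?ltnW // -!natr1 natrD; ring.
Qed.

End Rise.

(** * Alternating sums of binomial coefficients *)

Section Alternating.
Local Open Scope ring_scope.
Variable R : comNzRingType.

Lemma sum_alt_bin n N : (n < N)%N ->
  \sum_(0 <= k < N) (-1) ^+ k * 'C(n, k)%:R = (n == 0)%:R :> R.
Proof.
move=> nN; rewrite (big_cat_nat (n := n.+1)) //=.
rewrite [X in _ + X]big_nat_cond [X in _ + X]big1 ?addr0; last first.
  by move=> i /andP[/andP[lt_ni _] _]; rewrite bin_small // mulr0.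
rewrite big_mkord; have := exprDn (1 : R) (-1) n.
rewrite subrr expr0n => ->; apply: eq_bigr => i _.
by rewrite expr1n mul1r mulr_natr.
Qed.

Lemma sum_alt_even m : ~~ odd m ->
  \sum_(0 <= k < m.+1) (-1) ^+ k = 1 :> R.
Proof.
move=> ev; rewrite -(even_halfK ev); elim: m./2 => [|n IH].
  by rewrite big_nat1.
by rewrite doubleS big_nat_recr //= big_nat_recr //= IH !exprS; ring.
Qed.

Lemma ffactD M j k : (M ^_ (j + k) = M ^_ j * (M - j) ^_ k)%N.
Proof.
elim: k => [|k IH]; first by rewrite addn0 muln1.
by rewrite addnS !ffactnSr IH subnDA mulnA.
Qed.

Lemma bin_mul_fact M j k :
  ('C(M, j) * 'C(M - j, k) * (j`! * k`!) = M ^_ (j + k))%N.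
Proof. by rewrite ffactD -!bin_ffact mulnACA. Qed.

Lemma bin_mulC M j k : ('C(M, j) * 'C(M - j, k) = 'C(M, k) * 'C(M - k, j))%N.
Proof.
have f0 : (0 < j`! * k`!)%N by rewrite muln_gt0 !fact_gt0.
apply/eqP; rewrite -(eqn_pmul2r f0) bin_mul_fact addnC.
by rewrite [(j`! * _)%N]mulnC bin_mul_fact.
Qed.

Lemma sum_alt_bin2_row M N j : (M < N)%N ->
  \sum_(0 <= k < N) (-1) ^+ (j + k) * ('C(M, j) * 'C(M - j, k))%:R =
  (-1) ^+ M * (j == M)%:R :> R.
Proof.
move=> MN; under eq_bigr => k _ do rewrite exprD natrM mulrACA.
rewrite -mulr_sumr sum_alt_bin ?(leq_ltn_trans (leq_subr _ _)) //.
have [ltjM|ltMj|->] := ltngtP j M.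
- by rewrite subn_eq0 leqNgt ltjM !mulr0.
- by rewrite bin_small // !mulr0 mul0r.
- by rewrite binn subnn !mulr1.
Qed.

Lemma sum_alt_bin2_small p M : (M < p)%N ->
  \sum_(0 <= j < p) \sum_(0 <= k < p)
     (-1) ^+ (j + k) * ('C(M, j) * 'C(M - j, k))%:R = (-1) ^+ M :> R.
Proof.
move=> Mp; under eq_bigr => j _ do rewrite sum_alt_bin2_row //.
rewrite (bigD1_seq M) ?iota_uniq ?mem_index_iota //= eqxx mulr1.
by rewrite big1 ?addr0 // => j /negPf->; rewrite mulr0.
Qed.

(** The two ranges [j >= p] and [k >= p] have no common nonzero term, as
    [M < 2 p]; each contributes [(-1) ^ M] to the full sum [(-1) ^ M]. *)
Lemma sum_alt_bin2_large p M : (p <= M < p + p)%N ->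
  \sum_(0 <= j < p) \sum_(0 <= k < p)
     (-1) ^+ (j + k) * ('C(M, j) * 'C(M - j, k))%:R = - (-1) ^+ M :> R.
Proof.
move=> /andP[pM Mp].
pose T j k : R := (-1) ^+ (j + k) * ('C(M, j) * 'C(M - j, k))%:R.
rewrite -/(T _ _).
(* The full row sums to zero, because [j < p <= M]. *)
have row j : (j < p)%N -> \sum_(0 <= k < p) T j k =
    - \sum_(p <= k < p + p) T j k.
  move=> jp; apply/eqP; rewrite -addr_eq0 -big_cat_nat ?leq_addr //=.
  by rewrite sum_alt_bin2_row // ltn_eqF ?mulr0 // (leq_trans jp).
rewrite (eq_big_nat _ _ (F2 := fun j => - \sum_(p <= k < p + p) T j k));
  last by move=> j /andP[_ /row].
rewrite sumrN; congr (- _); rewrite exchange_big_nat /=.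
(* The terms with [j >= p] vanish, so the column can be summed in full. *)
have col k : (p <= k)%N ->
    \sum_(0 <= j < p) T j k = (-1) ^+ M * (k == M)%:R.
  move=> pk; rewrite -(sum_alt_bin2_row k Mp).
  rewrite [RHS](big_cat_nat (n := p)) ?leq_addr //=.
  rewrite [X in _ = _ + X]big_nat_cond [X in _ = _ + X]big1 ?addr0.
    by apply: eq_bigr => j _; rewrite /T addnC bin_mulC.
  move=> j /andP[/andP[pj _] _]; have [ltMk|leMk] := ltnP M k.
    by rewrite bin_small // mul0n mulr0.
  by rewrite ['C(M - k, _)]bin_small ?muln0 ?mulr0 //; lia.
rewrite (eq_big_nat _ _ (F2 := fun k => (-1) ^+ M * (k == M)%:R));
  last by move=> k /andP[/col].
rewrite (bigD1_seq M) ?iota_uniq ?mem_index_iota ?pM //= eqxx mulr1.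
by rewrite big1 ?addr0 // => j /negPf->; rewrite mulr0.
Qed.

End Alternating.

(** * The block sum in a ring where the cube of p is zero *)

Section Truncated.
Local Open Scope ring_scope.
Variables (R : comUnitRingType) (p : nat).
Hypotheses (p_pr : prime p) (p_gt2 : (2 < p)%N).
Hypothesis p3 : p%:R ^+ 3 = 0 :> R.
Hypothesis unit_lt_p : forall k, (0 < k < p)%N -> k%:R \is a @GRing.unit R.
Local Notation pi := (p%:R : R).

Lemma p_gt0 : (0 < p)%N. Proof. exact: prime_gt0. Qed.

Lemma odd_p : odd p.
Proof. by have [e|//] := even_prime p_pr; have := p_gt2; rewrite e. Qed.

Lemma unit2 : 2 \is a @GRing.unit R.
Proof. exact: unit_lt_p. Qed.

Lemma unit_fact m : (m < p)%N -> m`!%:R \is a @GRing.unit R.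
Proof.
elim: m => [|m IH] mp; first by rewrite unitr1.
by rewrite factS natrM unitrM unit_lt_p //= IH // ltnW.
Qed.

(** A polynomial of degree at most 2 in [p t]. *)
Definition quad1 (f : R -> R) := exists c0 c1 c2,
  forall t, f t = c0 + c1 * (pi * t) + c2 * (pi * t) ^+ 2.

Lemma quad1_rise m : quad1 (fun t => rise (pi * t) m).
Proof.
elim: m => [|m [c0 [c1 [c2 H]]]].
  by exists 1, 0, 0 => t; rewrite rise0; ring.
exists (c0 * m.+1%:R), (c0 + c1 * m.+1%:R), (c1 + c2 * m.+1%:R) => t.
rewrite riseS H; ring: p3.
Qed.

(** The inverse is a truncated geometric series, as [p] is nilpotent. *)
Lemma unit_add_nil x t : x \is a GRing.unit -> pi * t + x \is a GRing.unit.
Proof.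
move=> ux; apply/unitrP.
exists (x^-1 - pi * t * x^-1 ^+ 2 + (pi * t) ^+ 2 * x^-1 ^+ 3).
have e : x^-1 * x = 1 by rewrite mulVr.
by split; ring: p3 e.
Qed.

Lemma unit_rise t m : (m < p)%N -> rise (pi * t) m \is a GRing.unit.
Proof.
elim: m => [|m IH] mp; first by rewrite rise0 unitr1.
by rewrite riseS unitrM unit_add_nil ?unit_lt_p // andbT IH // ltnW.
Qed.

Lemma quad1_riseV m : (m < p)%N -> quad1 (fun t => (rise (pi * t) m)^-1).
Proof.
elim: m => [|m IH] mp.
  by exists 1, 0, 0 => t; rewrite rise0 invr1; ring.
have ux : m.+1%:R \is a @GRing.unit R by rewrite unit_lt_p.
have [c0 [c1 [c2 H]]] := IH (ltnW mp); pose v : R := m.+1%:R^-1.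
exists (c0 * v), (c1 * v - c0 * v ^+ 2), (c2 * v - c1 * v ^+ 2 + c0 * v ^+ 3).
move=> t; have uy := unit_add_nil t ux.
rewrite riseS invrM ?unit_rise 1?ltnW // H; apply: (mulrI uy).
have e : v * m.+1%:R = 1 by rewrite mulVr.
rewrite mulVKr //; move: {ux uy} m.+1%:R e => x e; ring: p3 e.
Qed.

(** A polynomial of degree at most 2 in three variables.  The powers of [p] that
    divide its coefficients in the application are not recorded. *)
Definition quad3 (f : R -> R -> R -> R) :=
  exists l0 l1 l2 l3 q11 q22 q33 q12 q13 q23, forall a b c, f a b c =
    l0 + l1 * a + l2 * b + l3 * c + q11 * a ^+ 2 + q22 * b ^+ 2 + q33 * c ^+ 2
    + q12 * (a * b) + q13 * (a * c) + q23 * (b * c).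

Lemma quad3_sum (I : Type) (r : seq I) (P : pred I) (f : I -> R -> R -> R -> R) :
  (forall i, P i -> quad3 (f i)) ->
  quad3 (fun a b c => \sum_(i <- r | P i) f i a b c).
Proof.
move=> H; elim: r => [|i r IH].
  by exists 0, 0, 0, 0, 0, 0, 0, 0, 0, 0 => a b c; rewrite big_nil; ring.
have [Pi|nPi] := boolP (P i); last first.
  have [l0 [l1 [l2 [l3 [q1 [q2 [q3 [q4 [q5 [q6 E]]]]]]]]]] := IH.
  exists l0, l1, l2, l3, q1, q2, q3, q4, q5, q6 => a b c.
  by rewrite big_cons (negPf nPi).
have [l0 [l1 [l2 [l3 [q1 [q2 [q3 [q4 [q5 [q6 E]]]]]]]]]] := IH.
have [m0 [m1 [m2 [m3 [r1 [r2 [r3 [r4 [r5 [r6 E']]]]]]]]]] := H _ Pi.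
exists (l0 + m0), (l1 + m1), (l2 + m2), (l3 + m3), (q1 + r1), (q2 + r2).
exists (q3 + r3), (q4 + r4), (q5 + r5), (q6 + r6) => a b c.
by rewrite big_cons Pi E E'; ring.
Qed.

Lemma quad3_mul f g h k : quad1 f -> quad1 g -> quad1 h -> quad1 k ->
  quad3 (fun a b c => f (a + b + c) * (g a * h b * k c)).
Proof.
move=> [f0 [f1 [f2 Hf]]] [g0 [g1 [g2 Hg]]] [h0 [h1 [h2 Hh]]] [k0 [k1 [k2 Hk]]].
exists (f0 * g0 * h0 * k0).
exists (pi * (f1 * g0 + f0 * g1) * h0 * k0).
exists (pi * (f1 * h0 + f0 * h1) * g0 * k0).
exists (pi * (f1 * k0 + f0 * k1) * g0 * h0).
exists (pi ^+ 2 * (f2 * g0 + f1 * g1 + f0 * g2) * h0 * k0).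
exists (pi ^+ 2 * (f2 * h0 + f1 * h1 + f0 * h2) * g0 * k0).
exists (pi ^+ 2 * (f2 * k0 + f1 * k1 + f0 * k2) * g0 * h0).
exists (pi ^+ 2 * (2 * f2 * g0 * h0 + f1 * g1 * h0 + f1 * g0 * h1
                   + f0 * g1 * h1) * k0).
exists (pi ^+ 2 * (2 * f2 * g0 * k0 + f1 * g1 * k0 + f1 * g0 * k1
                   + f0 * g1 * k1) * h0).
exists (pi ^+ 2 * (2 * f2 * h0 * k0 + f1 * h1 * k0 + f1 * h0 * k1
                   + f0 * h1 * k1) * g0).
move=> a b c; rewrite Hf Hg Hh Hk; ring: p3.
Qed.

(** The sum of [trinomial (a p + i) (b p + j) (c p + k)] over [i, j, k < p],
    divided by [trinomial (a p) (b p) (c p)] and extended to ring elements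
    [a], [b], [c]. *)
Definition blocksum (a b c : R) : R :=
  \sum_(0 <= i < p) \sum_(0 <= j < p) \sum_(0 <= k < p)
    rise (pi * (a + b + c)) (i + j + k) *
    ((rise (pi * a) i)^-1 * (rise (pi * b) j)^-1 * (rise (pi * c) k)^-1).

Lemma quad3_ext f g : (forall a b c, f a b c = g a b c) -> quad3 f -> quad3 g.
Proof.
move=> E [l0 [l1 [l2 [l3 [q1 [q2 [q3 [q4 [q5 [q6 H]]]]]]]]]].
by exists l0, l1, l2, l3, q1, q2, q3, q4, q5, q6 => a b c; rewrite -E.
Qed.

Lemma quad3_blocksum : quad3 blocksum.
Proof.
(* The bounds are repeated as conditions, so that [quad3_sum] provides them. *)
pose B a b c := \sum_(0 <= i < p | (i < p)%N) \sum_(0 <= j < p | (j < p)%N)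
   \sum_(0 <= k < p | (k < p)%N) rise (pi * (a + b + c)) (i + j + k) *
    ((rise (pi * a) i)^-1 * (rise (pi * b) j)^-1 * (rise (pi * c) k)^-1).
have dropP (F : nat -> R) :
    \sum_(0 <= i < p | (i < p)%N) F i = \sum_(0 <= i < p) F i.
  by rewrite big_nat_cond [RHS]big_nat_cond; apply: eq_bigl => i; lia.
apply: (@quad3_ext B).
  move=> a b c; rewrite /B dropP; apply: eq_bigr => i _.
  rewrite dropP; apply: eq_bigr => j _; exact: dropP.
apply: quad3_sum => i ip; apply: quad3_sum => j jp; apply: quad3_sum => k kp.
exact: (quad3_mul (quad1_rise _) (quad1_riseV ip) (quad1_riseV jp)
                  (quad1_riseV kp)).
Qed.

Lemma blocksumC a b c : blocksum a b c = blocksum b a c.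
Proof.
rewrite /blocksum exchange_big_nat /=; apply: eq_bigr => j _.
apply: eq_bigr => i _; apply: eq_bigr => k _.
by rewrite [(i + j)%N]addnC [a + b]addrC [in RHS](mulrC (_^-1) (rise (pi * a) i)^-1).
Qed.

Lemma blocksumAC a b c : blocksum a b c = blocksum a c b.
Proof.
rewrite /blocksum; apply: eq_bigr => i _; rewrite exchange_big_nat /=.
apply: eq_bigr => k _; apply: eq_bigr => j _.
by rewrite addnAC [a + b + c]addrAC [in RHS](mulrAC _ (rise (pi * c) k)^-1).
Qed.


(** * Values on the axis *)

(** The polynomial function Q whose translates by [i < p] sum to
    [blocksum a 0 0] at [x = p a]. *)
Definition axis_sum x : R :=
  \sum_(0 <= j < p) \sum_(0 <= k < p) rise x (j + k) * (j`!%:R^-1 * k`!%:R^-1).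

Lemma blocksum_axis a : blocksum a 0 0 = \sum_(0 <= i < p) axis_sum (pi * a + i%:R).
Proof.
rewrite /blocksum !addr0 mulr0; apply: eq_big_nat => i /andP[_ ip].
apply: eq_bigr => j _; apply: eq_bigr => k _.
rewrite -addnA riseD !rise_fact.
have e : rise (pi * a) i * (rise (pi * a) i)^-1 = 1 by rewrite divrr ?unit_rise.
by ring: e.
Qed.

Lemma axis_sum_opp M : axis_sum (- M.+1%:R) =
  \sum_(0 <= j < p) \sum_(0 <= k < p)
     (-1) ^+ (j + k) * ('C(M, j) * 'C(M - j, k))%:R.
Proof.
apply: eq_big_nat => j /andP[_ jp]; apply: eq_big_nat => k /andP[_ kp].
rewrite rise_opp -bin_mul_fact -mulrA; congr (_ * _).
rewrite -invrM ?unit_fact // [(j`! * _)%N]mulnC -natrM natrM mulrK //.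
by rewrite natrM unitrM !unit_fact.
Qed.

Lemma sum_sign : \sum_(0 <= i < p) (-1) ^+ i = 1 :> R.
Proof. by rewrite -(prednK p_gt0) sum_alt_even // -oddS prednK ?p_gt0 // odd_p. Qed.

Lemma signr_subl m i : ~~ odd m -> (i <= m)%N -> (-1) ^+ (m - i) = (-1) ^+ i :> R.
Proof. by move=> om im; rewrite -signr_odd oddB // (negPf om) signr_odd. Qed.

Lemma blocksum_axisN1 : blocksum (-1) 0 0 = 1.
Proof.
rewrite blocksum_axis -[RHS]sum_sign; apply: eq_big_nat => i /andP[_ ip].
have -> : pi * -1 + i%:R = - (p.-1 - i).+1%:R :> R.
  by rewrite -subSn ?prednK ?p_gt0 ?natrB ?(ltnW ip) //; [ring | lia].
rewrite axis_sum_opp sum_alt_bin2_small; last by lia.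
by rewrite signr_subl //; have := odd_p; lia.
Qed.

Lemma blocksum_axisN2 : blocksum (-2) 0 0 = 1.
Proof.
rewrite blocksum_axis -[RHS]sum_sign; apply: eq_big_nat => i /andP[_ ip].
have -> : pi * -2 + i%:R = - (p.-1 + p - i).+1%:R :> R.
  have -> : (p.-1 + p - i).+1 = (p + p - i)%N by lia.
  by rewrite natrB ?natrD; [ring | lia].
rewrite axis_sum_opp sum_alt_bin2_large; last by lia.
have -> : (p.-1 + p - i = (p.-1 + p.-1 - i).+1)%N by lia.
rewrite exprS signr_subl; [by ring| have := odd_p; lia | lia].
Qed.

(** Within the given bounds, [p - 1] is the only multiple of [p - 1]. *)
Lemma mul_sum_pow n : (0 < n < p.-1 + p.-1)%N -> n != p.-1 ->
  pi ^+ 2 * \sum_(0 <= i < p) i%:R ^+ n = 0.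
Proof.
move=> n_bnd n_p.
have /(dvdn_sum_pow p_pr)/dvdnP[q eq] : ~~ (p.-1 %| n)%N.
  by apply/negP => /dvdnP[[|[|m]] e]; move: n_bnd n_p; rewrite e; nia.
have -> : \sum_(0 <= i < p) i%:R ^+ n = q%:R * pi.
  by rewrite -natrM -eq natr_sum; apply: eq_bigr => i _; rewrite natrX.
ring: p3.
Qed.

(** [axis_sum] as a formal polynomial. *)
Definition axis_poly : {poly R} :=
  \sum_(0 <= j < p) \sum_(0 <= k < p)
    (j`!%:R^-1 * k`!%:R^-1) *: \prod_(l < j + k) ('X - (- l.+1%:R)%:P).

Lemma axis_polyE x : axis_poly.[x] = axis_sum x.
Proof.
rewrite /axis_poly horner_sum; apply: eq_bigr => j _.
rewrite horner_sum; apply: eq_bigr => k _.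
rewrite hornerZ horner_prod mulrC; congr (_ * _).
by apply: eq_bigr => l _; rewrite hornerXsubC opprK.
Qed.

Lemma size_axis_poly : (size axis_poly <= p.-1 + p)%N.
Proof.
rewrite /axis_poly big_nat; apply: (big_ind (fun q : {poly R} => size q <= p.-1 + p)%N).
- by rewrite size_poly0.
- by move=> f g Hf Hg; rewrite (leq_trans (size_polyD _ _)) // geq_max Hf.
move=> j jp; rewrite big_nat; apply: (big_ind (fun q : {poly R} => size q <= p.-1 + p)%N).
- by rewrite size_poly0.
- by move=> f g Hf Hg; rewrite (leq_trans (size_polyD _ _)) // geq_max Hf.
move=> k kp; rewrite (leq_trans (size_scale_leq _ _)) // size_prod_XsubC.
by rewrite -[index_enum _]enumT size_enum_ord; lia.
Qed.

Lemma taylor2 (q : {poly R}) x t : q.[x + pi * t] =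
  q.[x] + q^`N(1).[x] * (pi * t) + q^`N(2).[x] * (pi * t) ^+ 2.
Proof.
rewrite (@nderiv_taylor_wide _ (size q).+3) ?leqW //; last exact: mulrC.
rewrite !big_ord_recl big1 => [|i _]; last by rewrite !exprS; ring: p3.
by rewrite nderivn0 /=; ring.
Qed.

(** The sum of Q''(i) / 2 over [i < p] vanishes modulo [p]: expanded in powers
    of [i], the power sums are divisible by [p], except for the exponent [p - 1], whose
    coefficient is a multiple of [binomial (p + 1) 2]. *)
Lemma axis_poly2_sum : pi ^+ 2 * \sum_(0 <= i < p) axis_poly^`N(2).[i%:R] = 0.
Proof.
have sz : (size axis_poly^`N(2) <= p.-1 + p)%N.
  apply/leq_sizeP => n le_n; rewrite coef_nderivn nth_default ?mul0rn //.
  by rewrite (leq_trans size_axis_poly) // (leq_trans le_n) ?leq_addl.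
have -> : \sum_(0 <= i < p) axis_poly^`N(2).[i%:R] =
    \sum_(n < p.-1 + p) axis_poly^`N(2)`_n * \sum_(0 <= i < p) i%:R ^+ n.
  under eq_bigr => i _ do rewrite (horner_coef_wide _ sz).
  by rewrite exchange_big /=; apply: eq_bigr => n _; rewrite mulr_sumr.
rewrite mulr_sumr big1 // => n _; rewrite mulrCA coef_nderivn.
have [big_n|small_n] := leqP (p.-1 + p) (2 + n).
  by rewrite nth_default ?mul0rn ?mul0r // (leq_trans size_axis_poly).
have [n0|n_gt0] := posnP n.
  rewrite n0; under eq_bigr => i _ do rewrite expr0.
  by rewrite sumr_const_nat subn0; ring: p3.
have [np|np] := eqVneq (n : nat) p.-1; last by rewrite mul_sum_pow ?mulr0 //; lia.
have /dvdnP[m ->] : (p %| 'C(2 + n, 2))%N.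
  by rewrite np addSn add1n prednK ?p_gt0 // binS bin1 dvdn_addl // prime_dvd_bin.
by rewrite -[_ *+ (m * p)]mulr_natr natrM; ring: p3.
Qed.

Lemma blocksum_axis1 t : blocksum t 0 0 = 1.
Proof.
have [c0 [c1 H]] : exists c0 c1, forall t, blocksum t 0 0 = c0 + c1 * t.
  exists (\sum_(0 <= i < p) axis_poly.[i%:R]).
  exists (pi * \sum_(0 <= i < p) axis_poly^`N(1).[i%:R]) => {}t.
  rewrite blocksum_axis.
  under eq_bigr => i _ do rewrite -axis_polyE addrC taylor2.
  rewrite !big_split /= -!mulr_suml.
  have := axis_poly2_sum; set s2 := \sum_(_ <= _ < _) _^`N(2).[_] => e.
  by ring: e.
have := blocksum_axisN1; have := blocksum_axisN2; rewrite !H => e2 e1.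
have c1_0 : c1 = 0.
  have -> : c1 = (c0 + c1 * -1) - (c0 + c1 * -2) by ring.
  by rewrite e1 e2 subrr.
by move: e1; rewrite c1_0 !mul0r.
Qed.

(** * Values on a line of sum -1 *)

(** The sum over [k] of the terms with given [i] and [j] vanishes unless
    [i + j = p - 1]; the remaining terms are
    [(-1) ^ i (p - 1)! / rise (p a) (p - 1)]. *)
Lemma blocksum_plane a : blocksum a (-1 - a) 0 = p.-1`!%:R / rise (pi * a) p.-1.
Proof.
pose f : R := p.-1`!%:R; set V := rise (pi * a) p.-1.
have even_p1 : ~~ odd p.-1 by have := odd_p; lia.
have inner i j : \sum_(0 <= k < p) rise (- pi) (i + j + k) * k`!%:R^-1 =
    f * (i + j == p.-1)%N%:R.
  rewrite -{2}(prednK p_gt0).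
  rewrite (eq_big_nat _ _ (F2 := fun k => (-1) ^+ (i + j) * (p.-1 ^_ (i + j))%:R *
             ((-1) ^+ k * 'C(p.-1 - (i + j), k)%:R))); last first.
    move=> k /andP[_ kp].
    rewrite rise_opp ffactD -(bin_ffact (p.-1 - (i + j)) k) exprD !natrM !mulrA.
    by rewrite mulrK ?unit_fact //; ring.
  rewrite -mulr_sumr sum_alt_bin ?(leq_ltn_trans (leq_subr _ _)) ?ltn_predL ?p_gt0 //.
  rewrite subn_eq0; have [lt|gt|->] := ltngtP (i + j)%N p.-1.
  - by rewrite !mulr0.
  - by rewrite ffact_small // !(mulr0, mul0r).
  - by rewrite ffactnn -signr_odd (negPf even_p1) expr0 mul1r.
rewrite /blocksum -[RHS]mulr1 -[X in _ = _ * X]sum_sign mulr_sumr.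
apply: eq_big_nat => i /andP[_ ip].
have -> : pi * (a + (-1 - a) + 0) = - pi by ring.
under eq_bigr => j _.
  rewrite mulr0.
  under eq_bigr => k _ do rewrite rise_fact mulrCA.
  rewrite -mulr_sumr inner.
over.
have jI : (p.-1 - i)%N \in index_iota 0 p by rewrite mem_index_iota; lia.
rewrite (bigD1_seq _ jI) ?iota_uniq //= big1 => [|j /negPf jn]; last first.
  by rewrite (_ : _ == _ = false) ?mulr0 //; lia.
rewrite subnKC; last by lia.
rewrite eqxx mulr1 addr0.
have E : rise (pi * (-1 - a)) (p.-1 - i) * rise (pi * a) i = (-1) ^+ i * V.
  have -> : pi * (-1 - a) = - (p.-1 - i + i).+1%:R - pi * a.
    by rewrite subnK ?prednK ?p_gt0 //; [ring | lia].
  rewrite rise_reflect signr_subl //; last by lia.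
  rewrite -mulrA [_ * rise _ i]mulrC -riseD subnKC //; lia.
have uV : V \is a GRing.unit by rewrite unit_rise // ltn_predL p_gt0.
have ui : rise (pi * a) i \is a GRing.unit by rewrite unit_rise.
have uj : rise (pi * (-1 - a)) (p.-1 - i) \is a GRing.unit.
  by rewrite unit_rise //; lia.
have e : (rise (pi * a) i)^-1 * (rise (pi * (-1 - a)) (p.-1 - i))^-1 =
    (-1) ^+ i * V^-1.
  by rewrite -invrM // E invrM ?unitrX ?unitrN1 // -exprVn invrN1 mulrC.
by rewrite e -/f; ring.
Qed.

Lemma fermat_mod k : (0 < k < p)%N -> exists m, (k ^ p.-1 = m * p + 1)%N.
Proof.
move=> kp; have := Euler_exp_totient (a := k) (n := p).
rewrite totient_prime // => E; exists (k ^ p.-1 %/ p)%N.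
rewrite [LHS](divn_eq _ p) E ?modn_small ?prime_gt1 //.
by rewrite coprime_sym prime_coprime // gtnNdvd //; case/andP: kp.
Qed.

(** By Fermat's little theorem; only the class modulo [p] of the second factor
    matters, because [p ^ 3 = 0]. *)
Lemma mul_inv_sqr k : (0 < k < p)%N ->
  pi ^+ 2 * k%:R^-1 ^+ 2 = pi ^+ 2 * k%:R ^+ (p - 3).
Proof.
move=> kp; have [m e] := fermat_mod kp; have uk := unit_lt_p kp.
have e' : k%:R ^+ (p - 3) * k%:R ^+ 2 = m%:R * pi + 1 :> R.
  by rewrite -exprD -natrX (_ : p - 3 + 2 = p.-1)%N ?e ?natrD ?natrM //; lia.
apply: (mulIr (unitrX 2 uk)); rewrite -[LHS]mulrA -[RHS]mulrA e' -exprMn mulVr //.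
by ring: p3.
Qed.

Lemma prod_sqr_sub n : (n < p)%N ->
  \prod_(l < n) (l.+1%:R ^+ 2 - pi ^+ 2) =
  n`!%:R ^+ 2 * (1 - pi ^+ 2 * \sum_(l < n) l.+1%:R ^+ (p - 3)).
Proof.
elim: n => [|n IH] np; first by rewrite !big_ord0 fact0; ring.
rewrite !big_ord_recr /= IH ?(ltnW np) // factS natrM.
rewrite [pi ^+ 2 * (_ + _)]mulrDr -mul_inv_sqr //.
have e : n.+1%:R * n.+1%:R^-1 = 1 :> R by rewrite divrr ?unit_lt_p.
move: (n.+1%:R) (n.+1%:R^-1) e => x y e; ring: e p3.
Qed.

(** The case [t = -1] makes the linear and quadratic coefficients equal.  The
    product of the values at [1] and [-1] is that of the [k ^ 2 - p ^ 2], so for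
    [p > 3] the vanishing modulo [p] of the sum of the [k ^ (-2)] kills the
    coefficient; for [p = 3] the factor [3] does. *)
Lemma rise_quad : exists v, 3 * pi ^+ 2 * v = 0 /\
  forall t, rise (pi * t) p.-1 = p.-1`!%:R * (1 + pi ^+ 2 * v * (t * (t + 1))).
Proof.
pose f : R := p.-1`!%:R.
have p1p : (p.-1 < p)%N by rewrite ltn_predL p_gt0.
have uf : f \is a GRing.unit by rewrite unit_fact.
have ef : f * f^-1 = 1 by rewrite divrr.
have [c0 [c1 [c2 H]]] := quad1_rise p.-1.
have H0 : c0 = f by have := H 0; rewrite mulr0 rise_fact -/f => ->; ring.
have rN1 : rise (pi * -1) p.-1 = f.
  rewrite mulrN1 -{1}(prednK p_gt0) rise_opp ffactnn -signr_odd.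
  by rewrite (_ : odd p.-1 = false) ?mul1r //; have := odd_p; lia.
have H1 : c1 * pi = c2 * pi ^+ 2.
  have /eqP := H (-1); rewrite rN1 H0 -subr_eq0 => /eqP e.
  apply/eqP; rewrite -subr_eq0 -e; apply/eqP; ring.
have Hv t : rise (pi * t) p.-1 = f * (1 + pi ^+ 2 * (c2 * f^-1) * (t * (t + 1))).
  by rewrite H H0 [c1 * _]mulrA H1; ring: ef.
exists (c2 * f^-1); split; last exact: Hv.
move: Hv; set v := c2 * f^-1 => Hv.
have [p3E|p_n3] := eqVneq p 3%N.
  have -> : 3 = pi by rewrite p3E.
  by rewrite -exprS p3 mul0r.
have v2 : 2 * (pi ^+ 2 * v) = 0.
  have := prod_sqr_sub p1p.
  have -> : \prod_(l < p.-1) (l.+1%:R ^+ 2 - pi ^+ 2) =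
      rise (pi * 1) p.-1 * rise (pi * -1) p.-1.
    by rewrite /rise -big_split; apply: eq_bigr => l _ /=; ring.
  rewrite -/f; have -> : \sum_(l < p.-1) l.+1%:R ^+ (p - 3) =
      \sum_(0 <= i < p) i%:R ^+ (p - 3) :> R.
    rewrite -[X in index_iota _ X](prednK p_gt0) big_nat_recl // big_mkord expr0n.
    by rewrite (_ : _ == _ = false) ?add0r //; lia.
  rewrite mul_sum_pow; [|lia|lia].
  rewrite rN1 Hv => e; have := congr1 (fun x => x * f^-1 ^+ 2) e.
  have -> : f * (1 + pi ^+ 2 * v * (1 * (1 + 1))) * f * f^-1 ^+ 2 =
     1 + 2 * (pi ^+ 2 * v) by ring: ef.
  have -> : f ^+ 2 * (1 - 0) * f^-1 ^+ 2 = 1 by ring: ef.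
  by move=> e1; apply: (addrI 1); rewrite e1 addr0.
have v0 : pi ^+ 2 * v = 0 by apply: (mulrI unit2); rewrite v2 mulr0.
by rewrite -mulrA v0 mulr0.
Qed.

(** * The block sum is congruent to its corner *)

(** Symmetry and the values on the axes leave only the coefficients of [a b],
    [a c] and [b c], which are equal; the value at [(1, -2, 0)] yields [w]. *)
Lemma blocksum_quad : exists w : R, [/\ w * 3 = 0, w ^+ 2 = 0,
  forall t, rise (pi * t) p.-1 = p.-1`!%:R * (1 + w * (t * (t + 1)))
  & forall a b c, blocksum a b c = 1 + w * (a * b + b * c + c * a)].
Proof.
have [v [v3 Hv]] := rise_quad; exists (pi ^+ 2 * v).
have w3 : pi ^+ 2 * v * 3 = 0 by rewrite -v3; ring.
have w2 : (pi ^+ 2 * v) ^+ 2 = 0 by ring: p3.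
split=> //; move: (pi ^+ 2 * v) Hv w3 w2 => w Hw w3 w2.
have uf : p.-1`!%:R \is a @GRing.unit R by rewrite unit_fact // ltn_predL p_gt0.
have plane : blocksum 1 (-2) 0 = 1 - 2 * w.
  have -> : -2 = -1 - 1 :> R by ring.
  rewrite blocksum_plane Hw; set f : R := p.-1`!%:R.
  have e : (1 + w * (1 * (1 + 1))) * (1 - 2 * w) = 1 by ring: w2.
  have ux : 1 + w * (1 * (1 + 1)) \is a GRing.unit.
    by apply/unitrP; exists (1 - 2 * w); rewrite mulrC e.
  by apply: (mulrI ux); rewrite e invrM // mulrCA mulVKr // divrr.
have [l0 [l1 [l2 [l3 [q1 [q2 [q3 [q4 [q5 [q6 H]]]]]]]]]] := quad3_blocksum.
have X t : blocksum t 0 0 = 1 := blocksum_axis1 t.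
have Y t : blocksum 0 t 0 = 1 by rewrite blocksumC.
have Z t : blocksum 0 0 t = 1 by rewrite blocksumAC.
have E a b c : blocksum a b c = 1 + q4 * (a * b) + q5 * (a * c) + q6 * (b * c).
  have -> : 1 = blocksum a 0 0 + blocksum 0 b 0 + blocksum 0 0 c
                - 2 * blocksum 0 0 0.
    by rewrite X Y Z X; ring.
  by rewrite !H; ring.
have half x : 1 - 2 * x = 1 - 2 * w -> x = w.
  by move=> /addrI/oppr_inj/(mulrI unit2).
have q4w : q4 = w by apply: half; rewrite -plane E; ring.
have q5w : q5 = w by apply: half; rewrite -plane blocksumAC E; ring.
have q6w : q6 = w by apply: half; rewrite -plane blocksumAC blocksumC E; ring.
by move=> a b c; rewrite E q4w q5w q6w; ring.
Qed.

Lemma sum_trinomial_blocksum (a b c : nat) :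
  \sum_(0 <= i < p) \sum_(0 <= j < p) \sum_(0 <= k < p)
    (trinomial (a * p + i) (b * p + j) (c * p + k))%:R =
  (trinomial (a * p) (b * p) (c * p))%:R * blocksum a%:R b%:R c%:R.
Proof.
rewrite /blocksum mulr_sumr; apply: eq_big_nat => i /andP[_ ip].
rewrite mulr_sumr; apply: eq_big_nat => j /andP[_ jp].
rewrite mulr_sumr; apply: eq_big_nat => k /andP[_ kp].
have := trinomialD (a * p) (b * p) (c * p) i j k.
move=> /(congr1 (fun n => n%:R : R)).
rewrite !natrM -!rise_nat !natrD !natrM.
rewrite ![_ * pi]mulrC -!mulrDr => e.
have ui := unit_rise a%:R ip; have uj := unit_rise b%:R jp.
have uk := unit_rise c%:R kp.
have u : rise (pi * a%:R) i * rise (pi * b%:R) j * rise (pi * c%:R) k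
   \is a GRing.unit by rewrite !unitrM ui uj.
apply: (mulIr u); rewrite e.
have V3 (x y z x' y' z' : R) : x * x' = 1 -> y * y' = 1 -> z * z' = 1 ->
  x' * y' * z' * (x * y * z) = 1 by move=> ex ey ez; ring: ex ey ez.
by rewrite -[RHS]mulrA -[X in _ = _ * X]mulrA V3 ?mulr1 //; apply: divrr.
Qed.

Lemma sum_trinomial_block (a b c : nat) :
  \sum_(0 <= i < p) \sum_(0 <= j < p) \sum_(0 <= k < p)
    (trinomial (a * p + i) (b * p + j) (c * p + k))%:R =
  (trinomial a b c)%:R :> R.
Proof.
have [w [w3 w2 Hrise Hblock]] := blocksum_quad.
rewrite sum_trinomial_blocksum Hblock.
pose f : R := p.-1`!%:R.
have uf : f \is a GRing.unit by rewrite unit_fact // ltn_predL p_gt0.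
have GE n : (\prod_(j < n) (j * p + p.-1) ^_ p.-1)%N%:R =
    f ^+ n * (1 + w * (pronic_sum n)%:R).
  elim: n => [|n IH]; first by rewrite big_ord0 /pronic_sum big_geq //; ring.
  rewrite big_ord_recr natrM IH -rise_nat natrM [_ * pi]mulrC Hrise -/f.
  rewrite {2}/pronic_sum big_nat_recr //= -/(pronic_sum n) natrD natrM -natr1.
  by move: (pronic_sum n)%:R => S; clearbody f; rewrite exprS; ring: w2.
(* The powers of [(p - 1)!] cancel. *)
have := trinomial_mul_p a b c p_gt0 => /= /(congr1 (fun n => n%:R : R)).
rewrite !natrM !GE; set T := (trinomial (a * p) _ _)%:R.
set t : R := (trinomial a b c)%:R.
have -> : T * (f ^+ a * (1 + w * (pronic_sum a)%:R) *
    (f ^+ b * (1 + w * (pronic_sum b)%:R)) * (f ^+ c * (1 + w * (pronic_sum c)%:R))) = f ^+ (a + b + c) *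
    (T * (1 + w * ((pronic_sum a)%:R + (pronic_sum b)%:R + (pronic_sum c)%:R))).
  by rewrite !exprD; ring: w2.
rewrite [RHS]mulrCA => /(mulrI (unitrX _ uf)) eT.
have eD := congr1 (fun n => n%:R : R) (pronic_sumD a b c).
rewrite /= !(natrD, natrM) in eD.
have w_mul3 n : (3 %| n)%N -> w * n%:R = 0.
  by move=> /dvdnP[m ->]; rewrite natrM mulrCA w3 mulr0.
have := w_mul3 _ (dvd3_trinomial3 a b c).
have := w_mul3 _ (dvd3_trinomial2 a b c).
have := w_mul3 _ (dvd3_trinomial2 b c a).
have := w_mul3 _ (dvd3_trinomial2 c a b).
rewrite -(trinomialAC a c b) (trinomialC c a) (trinomialAC a c b).
rewrite (trinomialAC b c a) (trinomialC b a).
rewrite !natrM -!natr1 !natrD -/t => z1 z2 z3 z4.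
set M : R := (pronic_sum (a + b + c))%:R in eT eD.
set s := _ + _ + _ in eT.
have -> : T = t * (1 + w * M) * (1 - w * s) by rewrite -eT; ring: w2.
have -> : M = s + (a%:R + b%:R + c%:R) * (a%:R * b%:R + b%:R * c%:R + c%:R * a%:R)
              - a%:R * b%:R * c%:R by rewrite -eD addrK.
(* What remains besides [t] is a combination of multiples of 3 times [w]. *)
pose e3 (x y z : nat) : R := w * (t * (x%:R * y%:R * (x%:R + y%:R + z%:R + 1))).
transitivity (t + (e3 c a b + e3 b c a + e3 a b c
                   - w * (t * (a%:R * b%:R * c%:R)))).
  by rewrite /e3; clearbody s t; ring: w2.
by rewrite /e3 z1 z2 z3 z4 subr0 !addr0.
Qed.

Lemma sum_trinomial_multiples (r s t : nat) :
  (\sum_(0 <= m1 < r * p) \sum_(0 <= m2 < s * p) \sum_(0 <= m3 < t * p)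
      trinomial m1 m2 m3)%N%:R =
  (\sum_(0 <= m1 < r) \sum_(0 <= m2 < s) \sum_(0 <= m3 < t)
      trinomial m1 m2 m3)%N%:R :> R.
Proof.
have blocks (n : nat) (F : nat -> R) : \sum_(0 <= m < n * p) F m =
    \sum_(0 <= a < n) \sum_(0 <= i < p) F (a * p + i)%N.
  rewrite big_nat_mul; apply: eq_bigr => a _.
  rewrite -{1}[(a * p)%N]add0n big_addn mulSn addnK.
  by apply: eq_bigr => i _; rewrite addnC.
have natr_sum3 (x y z : nat) (F : nat -> nat -> nat -> nat) :
    (\sum_(0 <= i < x) \sum_(0 <= j < y) \sum_(0 <= k < z) F i j k)%N%:R =
    \sum_(0 <= i < x) \sum_(0 <= j < y) \sum_(0 <= k < z) (F i j k)%:R :> R.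
  rewrite natr_sum; apply: eq_bigr => i _; rewrite natr_sum.
  by apply: eq_bigr => j _; rewrite natr_sum.
rewrite !natr_sum3 blocks; apply: eq_bigr => a _.
under eq_bigr => i _ do rewrite blocks.
rewrite exchange_big_nat; apply: eq_bigr => b _ /=.
under eq_bigr => i _ do under eq_bigr => j _ do rewrite blocks.
under eq_bigr => i _ do rewrite exchange_big_nat.
rewrite exchange_big_nat; apply: eq_bigr => c _ /=.
exact: sum_trinomial_block.
Qed.

End Truncated.

Theorem theorem1 (p r s t : nat) (hp : prime p) (hp2 : 2 < p)
    (hr : 0 < r) (hs : 0 < s) (ht : 0 < t) :
  \sum_(0 <= m1 < r * p) \sum_(0 <= m2 < s * p) \sum_(0 <= m3 < t * p)
      trinomial m1 m2 m3
  = \sum_(0 <= m1 < r) \sum_(0 <= m2 < s) \sum_(0 <= m3 < t)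
      trinomial m1 m2 m3
  %[mod p ^ 3].
Proof.
have q1 : 1 < p ^ 3 by rewrite (ltn_exp2l 0) // prime_gt1.
have p3 : (p%:R ^+ 3 = 0 :> 'Z_(p ^ 3))%R by rewrite -natrX pchar_Zp.
have up k : 0 < k < p -> (k%:R \is a @GRing.unit 'Z_(p ^ 3))%R.
  by case/andP=> k0 kp; rewrite unitZpE // coprimeXl // prime_coprime // gtnNdvd.
have /(congr1 val) := sum_trinomial_multiples hp hp2 p3 up r s t.
by rewrite /= !val_Zp_nat.
Qed.
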